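(* Suppose that $F=f+\delta_{\mathcal M}$ is a KL function and that $\phi_+':\mathbb{R}_+\to\mathbb{R}_+$ is locally Lipschitz. Then every sequence $\{x^k\}$ generated by the algorithm $\mathsf{ManPPA}_{\mathsf{rw}}$ converges to a stationary point of the problem $\min\{f(x): x\in\mathcal M\}$.
   Context: Setting. $Y\in\mathbb{R}^{n\times p}$; $\phi:\mathbb{R}_+\to\mathbb{R}_+$ is a continuous concave function with $\phi(0)=0$, differentiable on $(0,\infty)$, such that the limit $\ell:=\lim_{s\downarrow0}\phi'(s)$ exists (in $\mathbb{R}$). $\phi_+'(s)=\lim_{h\downarrow0}\frac{\phi(s+h)-\phi(s)}{h}$ is the right derivative, and $\Phi_+'(y)=(\phi_+'(y_1),\dots,\phi_+'(y_p))$ for $y\in\mathbb{R}^p_+$. $|y|$ is the vector of entrywise absolute values. $f(x)=\sum_{i=1}^p\phi(|[Y^Tx]_i|)$, $\mathcal M=\{u\in\mathbb{R}^n:\|u\|=1\}$ (Euclidean norm), $\delta_{\mathcal M}$ is the indicator function of $\mathcal M$ ($0$ on $\mathcal M$, $+\infty$ elsewhere). $L_f:=\ell\sqrt p\,\|Y\|_2$, with $\|\cdot\|_2$ the operator norm. Algorithm $\mathsf{ManPPA}_{\mathsf{rw}}$. Choose $x^0\in\mathcal M$ and $t\in(0,2/L_f)$. For $k=0,1,2,\dots$: set $u^k=\Phi_+'(|Y^Tx^k|)$; let $d^k$ be the (unique) minimizer of $d\mapsto\sum_{i=1}^p u_i^k|[Y^T(x^k+d)]_i|+\frac1{2t}\|d\|^2$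 over $\{d\in\mathbb{R}^n:\langle x^k,d\rangle=0\}$; set $x^{k+1}=\frac{x^k+d^k}{\|x^k+d^k\|}$. Subdifferentials. For a proper closed $h:\mathbb{R}^m\to(-\infty,\infty]$ and $\bar x\in\mathrm{dom}\,h$, the regular subdifferential is $\widehat\partial h(\bar x)=\{v:\liminf_{x\to\bar x,x\ne\bar x}\frac{h(x)-h(\bar x)-\langle v,x-\bar x\rangle}{\|x-\bar x\|}\ge0\}$ and the limiting subdifferential is $\partial h(\bar x)=\{v:\exists x^k\to\bar x,\ h(x^k)\to h(\bar x),\ v^k\in\widehat\partial h(x^k),\ v^k\to v\}$; both are empty outside $\mathrm{dom}\,h$; $\mathrm{dom}\,\partial h=\{x:\partial h(x)\ne\emptyset\}$. A point $x^*$ is a stationary point of $\min\{f(x):x\in\mathcal M\}$ if $0\in\partial F(x^* )$. KL property. A proper closed $h$ satisfies the KL property at $\hat x\in\mathrm{dom}\,\partial h$ if there are $a\in(0,\infty]$, a neighborhood $V$ of $\hat x$ and a continuous concave $\varphi:[0,a)\to[0,\infty)$ with $\varphi(0)=0$, continuously differentiable on $(0,a)$ with $\varphi'>0$ there, such that $\varphi'(h(x)-h(\hat x))\,\mathrm{dist}(0,\partial h(x))\ge1$ for all $x\in V$ with $h(\hat x)<h(x)<h(\hat x)+a$ (where the distance to the empty set is $+\infty$). $h$ is a KL function if it satisfies the KL property at every point of $\mathrm{dom}\,\partial h$. *)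

(* Defs.v *)
From HB Require Import structures.
From mathcomp Require Import all_boot all_order all_algebra.
From mathcomp Require Import all_classical all_reals all_analysis.

Set Implicit Arguments.
Unset Strict Implicit.
Unset Printing Implicit Defensive.

Import Order.TTheory GRing.Theory Num.Theory.
Import numFieldNormedType.Exports.

Local Open Scope ring_scope.
Local Open Scope classical_set_scope.

(* Vectors of R^n are column matrices ['cV[R]_n]. The library norm [`|x|] on
   matrices is the sup norm, so the Euclidean norm is introduced here; limits
   and neighbourhoods use the library topology, which is the usual one. *)
Definition edot (R : realType) (n : nat) (x y : 'cV[R]_n) : R :=
  \sum_(i < n) x i 0 * y i 0.

Definition enorm (R : realType) (n : nat) (x : 'cV[R]_n) : R :=
  Num.sqrt (edot x x).

Definition opnorm (R : realType) (m n : nat) (A : 'M[R]_(m, n)) : R :=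
  sup [set enorm (A *m x) | x in [set x : 'cV[R]_n | enorm x <= 1]].

Definition sphere (R : realType) (n : nat) : set 'cV[R]_n :=
  [set x | enorm x = 1].
Arguments sphere : clear implicits.

Definition indicator (R : realType) (T : Type) (A : set T) (x : T) : \bar R :=
  if x \in A then 0%E else +oo%E.

(* Real functions whose mathematical domain is [0, +oo[ or [0, a[ are total
   functions R -> R; their values off that domain are never used. *)
Definition concave_on (R : realType) (D : set R) (f : R -> R) : Prop :=
  convex_function (D : set (convex_lmodType R^o)) (fun s => - f s : R^o).

Definition right_deriv (R : realType) (f : R -> R) (s : R) : R :=
  lim ((f (s + h) - f s) / h @[h --> 0^'+]).

Definition locally_lipschitz_on (R : realType) (D : set R) (g : R -> R) : Prop :=
  forall s, D s -> exists2 V, nbhs s V & [lipschitz g r | r in V `&` D].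

(* Generalized subdifferentials and the KL property are meant for proper closed
   h : R^n -> ]-oo, +oo]. They are defined for every h : R^n -> \bar R; properness
   and lower semicontinuity are not part of the definitions, and hold for the
   only function they are applied to, [penalized] below with a nonempty sphere. *)
Section Subdifferential.
Context {R : realType} {n : nat}.
Implicit Types (h : 'cV[R]_n -> \bar R) (x v : 'cV[R]_n).

Definition regular_subdiff h x : set 'cV[R]_n :=
  [set v | (h x < +oo)%E /\
    (0 <= limf_einf (fun y => (h y - h x - (edot v (y - x))%:E)
                              / (enorm (y - x))%:E) x^')%E].

Definition limiting_subdiff h x : set 'cV[R]_n :=
  [set v | (h x < +oo)%E /\
    exists y w : nat -> 'cV[R]_n,
      [/\ y k @[k --> \oo] --> x,
          h (y k) @[k --> \oo] --> h x,
          forall k, regular_subdiff h (y k) (w k) &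
          w k @[k --> \oo] --> v]].

Definition dom_subdiff h : set 'cV[R]_n :=
  [set x | limiting_subdiff h x !=set0].

(* dist(0, A), equal to +oo when A is empty. *)
Definition dist0 (A : set 'cV[R]_n) : \bar R :=
  ereal_inf [set (enorm v)%:E | v in A].

(* In the last clause [h x - h xhat] is finite, so [fine] is harmless. *)
Definition KL_property h (xhat : 'cV[R]_n) : Prop :=
  dom_subdiff h xhat /\
  exists (a : \bar R) (V : set 'cV[R]_n) (psi : R -> R),
    let D := [set s : R | 0 <= s /\ (s%:E < a)%E] in
    [/\ (0 < a)%E, nbhs xhat V,
        [/\ {within D, continuous psi}, concave_on D psi, psi 0 = 0 &
            forall s, D s -> 0 <= psi s],
        (forall s : R, 0 < s -> (s%:E < a)%E ->
           [/\ derivable psi s 1, {for s, continuous psi^`()} &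
               0 < psi^`() s]) &
        (forall x, V x -> (h xhat < h x)%E -> (h x < h xhat + a)%E ->
           (1 <= ((psi^`()%classic) (fine (h x - h xhat)))%:E
                 * dist0 (limiting_subdiff h x))%E)].

Definition KL_function h : Prop :=
  forall x, dom_subdiff h x -> KL_property h x.

End Subdifferential.

Section Problem.
Context {R : realType} {n p : nat}.
Variables (phi : R -> R) (Y : 'M[R]_(n, p)).

Definition objective (x : 'cV[R]_n) : R :=
  \sum_(i < p) phi `|(Y^T *m x) i 0|.

Definition penalized (x : 'cV[R]_n) : \bar R :=
  ((objective x)%:E + indicator R (sphere R n) x)%E.

Definition stationary (x : 'cV[R]_n) : Prop := limiting_subdiff penalized x 0.

Definition Lconst (ell : R) : R := ell * Num.sqrt p%:R * opnorm Y.

Definition weights (x : 'cV[R]_n) : 'cV[R]_p :=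
  \col_i right_deriv phi `|(Y^T *m x) i 0|.

Definition subproblem (t : R) (u : 'cV[R]_p) (x d : 'cV[R]_n) : R :=
  \sum_(i < p) u i 0 * `|(Y^T *m (x + d)) i 0| + (2 * t)^-1 * enorm d ^+ 2.

(* The minimizer over {d | <x, d> = 0} is unique by strong convexity. *)
Definition subproblem_minimizer (t : R) (u : 'cV[R]_p) (x d : 'cV[R]_n) : Prop :=
  edot x d = 0 /\
  forall e, edot x e = 0 -> subproblem t u x d <= subproblem t u x e.

Definition ManPPA_rw (t : R) (x : nat -> 'cV[R]_n) : Prop :=
  sphere R n (x 0%N) /\
  exists d : nat -> 'cV[R]_n, forall k,
    subproblem_minimizer t (weights (x k)) (x k) (d k) /\
    x k.+1 = (enorm (x k + d k))^-1 *: (x k + d k).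

End Problem.

(* Main.v *)
Require Import Defs.
From mathcomp Require Import all_boot all_order all_algebra.
From mathcomp Require Import all_classical all_reals all_analysis.
From mathcomp Require Import ring lra.

(** Write [x' = (x + d) / |x + d|] for one step of the method and [u] for the
    weights at [x].

    The step [d] minimises a convex model over the tangent space of the sphere, so
    it satisfies [Y (u . xi) + d / t = lam x] for subgradients [xi i] of the absolute
    value at the coordinates of [Y^T (x + d)] ([subproblem_optimality]).  Three
    estimates follow.
    - The step is short: [|x' - x| <= |d|], because [|x + d|^2 = 1 + |d|^2]
      ([step_length]).
    - The objective decreases: [f x' <= f x - |d|^2 / t] ([step_descent]).  Testing
      the optimality condition against [d] gives this decrease for the weighted
      l1-model between [x] and [x + d]; the model is positively homogeneous and
      [|x + d| >= 1], so it does not increase under normalisation; and by concavity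
      of [phi] the model bounds the increments of [f] from above.
    - [F] has a subgradient of norm [O(|d|)] at [x'] ([step_subgradient]).  The
      coordinates of [Y^T x'] have the signs of those of [Y^T (x + d)], so the same
      [xi] serve at [x']; only the weights have to be updated, at a Lipschitz cost,
      and the multiple of [x] becomes a multiple of [x'], normal to the sphere.

    The sphere being compact, the iterates have a cluster point [xbar]
    ([sphere_cluster]).  The decrease forces [|d k|] to tend to [0], so the third
    estimate makes [xbar] stationary ([cluster_stationary]).  In particular the
    Kurdyka-Lojasiewicz inequality is available at [xbar]; combined with the decrease
    and the subgradient bound it gives
    [2 |d k.+1| <= |d k| + (b k.+1 - b k.+2)], where [b] is a multiple of the
    desingularising function evaluated at the gap [f (x k) - f xbar] ([kl_step]).
    Hence [|x k.+1 - xbar| + |d k| + b k.+1] is nonincreasing near [xbar], and since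
    it is arbitrarily small along a subsequence the whole sequence converges to
    [xbar] ([kl_recursion_cvg]). *)

Set Implicit Arguments.
Unset Strict Implicit.
Unset Printing Implicit Defensive.

Import Order.TTheory GRing.Theory Num.Theory.
Import numFieldNormedType.Exports.
Local Open Scope ring_scope.
Local Open Scope classical_set_scope.

(** * Euclidean geometry of column vectors *)

Section Euclid.
Context {R : realType} {n : nat}.
Implicit Types (x y z : 'cV[R]_n) (a : R).

Lemma edotC x y : edot x y = edot y x.
Proof. by apply: eq_bigr => i _; rewrite mulrC. Qed.

Lemma edotDl x y z : edot (x + y) z = edot x z + edot y z.
Proof.
by rewrite /edot -big_split; apply: eq_bigr => i _; rewrite mxE mulrDl.
Qed.

Lemma edotZl a x y : edot (a *: x) y = a * edot x y.
Proof. by rewrite /edot mulr_sumr; apply: eq_bigr => i _; rewrite mxE mulrA. Qed.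

Lemma edotNl x y : edot (- x) y = - edot x y.
Proof. by rewrite -scaleN1r edotZl mulN1r. Qed.

Lemma edotDr x y z : edot x (y + z) = edot x y + edot x z.
Proof. by rewrite edotC edotDl !(edotC x). Qed.

Lemma edotZr a x y : edot x (a *: y) = a * edot x y.
Proof. by rewrite edotC edotZl edotC. Qed.

Lemma edotNr x y : edot x (- y) = - edot x y.
Proof. by rewrite edotC edotNl edotC. Qed.

Lemma edotxx_ge0 x : 0 <= edot x x.
Proof. by apply: sumr_ge0 => i _; rewrite -expr2 sqr_ge0. Qed.

Lemma enorm_ge0 x : 0 <= enorm x.
Proof. exact: sqrtr_ge0. Qed.

Lemma sqr_enorm x : enorm x ^+ 2 = edot x x.
Proof. by rewrite sqr_sqrtr ?edotxx_ge0. Qed.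

Lemma coord_le_enorm x i : `|x i 0| <= enorm x.
Proof.
rewrite -ler_sqr ?nnegrE ?enorm_ge0// sqr_enorm real_normK ?num_real// expr2.
rewrite /edot (bigD1 i)//= lerDl.
by apply: sumr_ge0 => j _; rewrite -expr2 sqr_ge0.
Qed.

Lemma enorm_eq0 x : enorm x = 0 -> x = 0.
Proof.
move=> x0; apply/matrixP => i j; rewrite ord1 mxE.
by apply/eqP; rewrite -normr_le0 -x0 coord_le_enorm.
Qed.

Lemma enorm0 : enorm (0 : 'cV[R]_n) = 0.
Proof.
rewrite /enorm /edot big1 ?sqrtr0// => i _.
by rewrite mxE mul0r.
Qed.

Lemma enormZ a x : enorm (a *: x) = `|a| * enorm x.
Proof.
by rewrite /enorm edotZl edotZr mulrA -expr2 sqrtrM ?sqr_ge0// sqrtr_sqr.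
Qed.

Lemma enormN x : enorm (- x) = enorm x.
Proof. by rewrite -scaleN1r enormZ normrN1 mul1r. Qed.

Lemma cauchy_schwarz x y : `|edot x y| <= enorm x * enorm y.
Proof.
have [y0|y0] := eqVneq (enorm y) 0.
  rewrite (enorm_eq0 y0) enorm0 mulr0 /edot big1 ?normr0// => i _.
  by rewrite mxE mulr0.
rewrite -ler_sqr ?nnegrE ?mulr_ge0 ?enorm_ge0//.
rewrite exprMn !sqr_enorm real_normK ?num_real//.
have yy : 0 < edot y y by rewrite -sqr_enorm exprn_gt0// lt_def y0 enorm_ge0.
(* the projection residual [x - (<x,y>/<y,y>) y] has nonnegative square *)
have := edotxx_ge0 (edot y y *: x - edot x y *: y).
rewrite edotDl !edotDr !edotNl !edotNr !edotZl !edotZr (edotC y x).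
set a := edot x y; set b := edot y y; set c := edot x x => h.
rewrite -subr_ge0 -(pmulr_rge0 _ yy) -/b.
by apply: le_trans h _; rewrite le_eqVlt; apply/orP; left; apply/eqP; ring.
Qed.

Lemma ler_enormD x y : enorm (x + y) <= enorm x + enorm y.
Proof.
rewrite -ler_sqr ?nnegrE ?addr_ge0 ?enorm_ge0//.
rewrite sqrrD !sqr_enorm edotDl !edotDr (edotC y x).
have := le_trans (ler_norm _) (cauchy_schwarz x y).
by lra.
Qed.

Lemma enorm_le_sum x : enorm x <= \sum_i `|x i 0|.
Proof.
have S0 : 0 <= \sum_i `|x i 0| by apply: sumr_ge0.
rewrite -ler_sqr ?nnegrE ?enorm_ge0// sqr_enorm expr2 mulr_suml.
apply: ler_sum => i _; apply: le_trans (ler_norm _) _; rewrite normrM.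
by rewrite ler_wpM2l// (bigD1 i)//= lerDl sumr_ge0.
Qed.

Lemma nbhs_enormP x (V : set 'cV[R]_n) :
  nbhs x V <-> exists2 r, 0 < r & forall y, enorm (y - x) < r -> V y.
Proof.
split=> [/nbhs_ballP[r /= r0 rV]|[r r0 rV]].
  exists r => // y yr; apply: rV; split=> // i j; rewrite ord1.
  rewrite -ball_normE/= distrC.
  by have := coord_le_enorm (y - x) i; rewrite !mxE => /le_lt_trans; apply.
have e0 : 0 < r / n.+1%:R by rewrite divr_gt0.
apply/nbhs_ballP; exists (r / n.+1%:R) => //= y [_ yr]; apply: rV.
apply: le_lt_trans (enorm_le_sum _) _.
apply: (@le_lt_trans _ _ (\sum_(i < n) r / n.+1%:R)).
  apply: ler_sum => i _; apply: ltW; rewrite !mxE distrC.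
  by have := yr i 0; rewrite -ball_normE.
rewrite sumr_const card_ord -[ltLHS]mulr_natl mulrA ltr_pdivrMr// mulrC ltr_pM2l//.
by rewrite ltr_nat.
Qed.

Lemma cvg_enorm (u : nat -> 'cV[R]_n) x :
  (enorm (u k - x) @[k --> \oo] --> (0 : R)) -> u k @[k --> \oo] --> x.
Proof.
move=> ux V /nbhs_enormP[r r0 rV].
move/cvgrPdist_lt: ux => /(_ _ r0); apply: filterS => k.
by rewrite sub0r normrN ger0_norm ?enorm_ge0// => /rV.
Qed.

End Euclid.

(** The transposes of the points [x k] lie in a product of compact intervals. *)
Lemma sphere_cluster (R : realType) (n : nat) (x : nat -> 'cV[R]_n) :
  (forall k, sphere R n (x k)) ->
  exists xbar, forall e N, 0 < e ->
    exists2 k, (N <= k)%N & enorm (x k - xbar) < e.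
Proof.
move=> xS.
have cK := @rV_compact R n (fun=> `[-1, 1]%classic)
  (fun=> @segment_compact R _ _).
pose y k := (x k)^T.
have [|q [Kq clq]] := cK (y @ \oo).
  exists 0%N => // k _ i /=; rewrite in_itv/= -ler_norml mxE.
  by rewrite (le_trans (coord_le_enorm _ _))// (xS k).
exists q^T => e N e0.
have e1 : 0 < e / n.+1%:R by rewrite divr_gt0.
have [||v [[k Nk <-] [_ qk]]] := clq [set v | exists2 k, (N <= k)%N & y k = v]
  (ball q (e / n.+1%:R)).
- by exists N => // k Nk; exists k.
- exact: nbhsx_ballx.
exists k => //; apply: le_lt_trans (enorm_le_sum _) _.
apply: (@le_lt_trans _ _ (\sum_(i < n) e / n.+1%:R)).
  apply: ler_sum => i _; apply: ltW; rewrite !mxE distrC.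
  by have := qk 0 i; rewrite -ball_normE/= mxE.
rewrite sumr_const card_ord -[ltLHS]mulr_natl mulrA ltr_pdivrMr// mulrC ltr_pM2l//.
by rewrite ltr_nat.
Qed.

Section DataMatrix.
Context {R : realType} {n p : nat}.
Variable Y : 'M[R]_(n, p).

(** The sum of the column norms dominates the operator norms of both [Y] and
    [Y^T]; any such constant serves in the estimates below. *)
Definition mxbound : R := \sum_i enorm (col i Y).

Lemma mxbound_ge0 : 0 <= mxbound.
Proof. by apply: sumr_ge0 => i _; exact: enorm_ge0. Qed.

Lemma trmx_mulE i x : (Y^T *m x) i 0 = edot (col i Y) x.
Proof. by rewrite mxE; apply: eq_bigr => j _; rewrite !mxE. Qed.

Lemma edot_mulmx w x : edot (Y *m w) x = \sum_i w i 0 * (Y^T *m x) i 0.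
Proof.
rewrite /edot.
under eq_bigr do rewrite mxE mulr_suml.
rewrite exchange_big/=; apply: eq_bigr => i _.
rewrite trmx_mulE /edot mulr_sumr; apply: eq_bigr => j _.
by rewrite mxE mulrCA mulrA.
Qed.

Lemma trmx_mul_le i x : `|(Y^T *m x) i 0| <= mxbound * enorm x.
Proof.
rewrite trmx_mulE (le_trans (cauchy_schwarz _ _))// ler_wpM2r ?enorm_ge0//.
by rewrite /mxbound (bigD1 i)//= lerDl sumr_ge0// => j _; exact: enorm_ge0.
Qed.

Lemma mulmx_le (w : 'cV[R]_p) c :
  (forall i, `|w i 0| <= c) -> enorm (Y *m w) <= mxbound * c.
Proof.
move=> wc.
have -> : Y *m w = \sum_i w i 0 *: col i Y.
  apply/matrixP => i j; rewrite ord1 mxE summxE; apply: eq_bigr => k _.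
  by rewrite !mxE mulrC.
rewrite /mxbound mulr_suml.
elim/big_ind2 : _ => [|a b a' b' h h'|i _].
- by rewrite enorm0.
- by rewrite (le_trans (ler_enormD _ _))// lerD.
- by rewrite enormZ mulrC ler_wpM2l ?enorm_ge0.
Qed.

End DataMatrix.

(** * Concave functions and local Lipschitz continuity of one real variable *)

Section Concave.
Context {R : realType}.
Implicit Types (D : set R) (f g : R -> R).

Lemma concave_chord D f (x y a : R) : concave_on D f -> D x -> D y ->
  0 <= a -> a <= 1 -> a * f x + (1 - a) * f y <= f (a * x + (1 - a) * y).
Proof.
move=> cf Dx Dy a0 a1.
have : - f (a * x + (1 - a) * y) <= a * - f x + (1 - a) * - f y.
  exact: cf (Itv01 a0 a1) x y (mem_set Dx) (mem_set Dy).
by rewrite !mulrN -opprD lerN2.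
Qed.

Lemma derive_expansion f (x : R) : derivable f x 1 -> forall e, 0 < e ->
  exists2 r, 0 < r & forall h, `|h| < r ->
    `|f (x + h) - f x - derive1 f x * h| <= e * `|h|.
Proof.
move=> df e e0.
have := df; rewrite /derivable => /cvgrPdist_le /(_ _ e0).
rewrite -/('D_1 f x) -derive1E => /nbhs_ballP[r /= r0 hr].
exists r => // h hlt; have [->|h0] := eqVneq h 0.
  by rewrite addr0 mulr0 !subrr normr0 mulr0.
have := hr h; rewrite -ball_normE/= sub0r normrN => /(_ hlt h0).
rewrite /GRing.scale/= mulr1 (addrC h x) => le1.
have -> : f (x + h) - f x - derive1 f x * h =
    - ((derive1 f x - h^-1 * (f (x + h) - f x)) * h).
  by field.
by rewrite normrN normrM ler_wpM2r.
Qed.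

(** Divide the chord inequality [f (x + a (y - x)) - f x >= a (f y - f x)] by [a]
    and let [a] tend to [0]. *)
Lemma concave_tangent D f (x y : R) : concave_on D f -> D x -> D y ->
  derivable f x 1 -> f y <= f x + derive1 f x * (y - x).
Proof.
move=> cf Dx Dy df; apply/ler_addgt0Pr => e e0.
set v := y - x; have v1 : 0 < `|v| + 1 by rewrite ltr_wpDl.
have [r r0 hr] := derive_expansion df (divr_gt0 e0 v1).
pose a := Num.min 1 (r / 2 / (`|v| + 1)).
have a0 : 0 < a by rewrite lt_min ltr01 !divr_gt0.
have a1 : a <= 1 by rewrite ge_min lexx.
have av : `|a * v| < r.
  rewrite normrM (gtr0_norm a0).
  apply: (@le_lt_trans _ _ (r / 2 / (`|v| + 1) * (`|v| + 1))).
    by apply: ler_pM; rewrite ?(ltW a0)// ?ge_min ?lexx ?orbT// lerDl.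
  by rewrite divfK ?gt_eqF// ltr_pdivrMr// ltr_pMr// ltr1n.
have := hr _ av; rewrite normrM (gtr0_norm a0) => /(le_trans (ler_norm _)).
have := concave_chord cf Dy Dx (ltW a0) a1.
have -> : a * y + (1 - a) * x = x + a * v by rewrite /v; ring.
have ve : e / (`|v| + 1) * (a * `|v|) <= a * e.
  rewrite mulrCA ler_wpM2l ?(ltW a0)// -mulrA ler_piMr ?(ltW e0)//.
  by rewrite mulrC ler_pdivrMr// mul1r lerDl.
move=> h1 h2; rewrite -(ler_pM2l a0).
by lra.
Qed.

End Concave.

(** Uniformity over a compact interval: the near-covering form of compactness
    gives one [i] that is a Lipschitz constant for points at distance less than [1 / i];
    points further apart than [1 / i] are handled by boundedness. *)
Lemma bounded_locally_lipschitz_itv (R : realType) (g : R -> R) (M B : R) :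
  locally_lipschitz_on `[0, +oo[ g ->
  (forall s r, 0 <= s -> 0 <= r -> `|g s - g r| <= B) ->
  exists2 K, 0 <= K & forall s r, 0 <= s -> 0 <= r -> s <= M ->
    `|g s - g r| <= K * `|s - r|.
Proof.
move=> gl gB.
have B0 : 0 <= B by apply: le_trans (gB 0 0 _ _).
pose P (i s : R) := forall r, 0 <= r -> `|s - r| < i^-1 ->
  `|g s - g r| <= i * `|s - r|.
have : \forall i \near +oo, `[0, M]%classic `<=` P i.
  have /compact_near_coveringP/near_covering_withinP := @segment_compact R 0 M.
  apply => s; rewrite /= in_itv/= => /andP[s0 _].
  have [|V /nbhs_ballP[e /= e0 eV] gV] := gl s.
    by rewrite /= in_itv/= s0.
  have e20 : 0 < e / 2 by rewrite divr_gt0.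
  near=> s' i => /=; rewrite in_itv/= => /andP[s'0 _] r r0 s'r.
  have is' : `|s - s'| < e / 2.
    by near: s'; apply/nbhs_ballP; exists (e / 2) => //= z; rewrite -ball_normE.
  have ie : i^-1 < e / 2.
    have i0 : 0 < i by near: i; apply: nbhs_pinfty_gt; rewrite num_real.
    have ii : (e / 2)^-1 < i by near: i; apply: nbhs_pinfty_gt; rewrite num_real.
    by rewrite -[ltRHS]invrK ltf_pV2 ?posrE ?invr_gt0.
  have Lip : forall z : R * R, (V `&` `[0, +oo[) z.1 /\ (V `&` `[0, +oo[) z.2 ->
      `|g z.1 - g z.2| <= i * `|z.1 - z.2| by near: i; exact: gV.
  apply: (Lip (s', r)); split; split => /=; rewrite ?in_itv/= ?s'0 ?r0//;
    apply: eV; rewrite -ball_normE/=.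
    by lra.
  by rewrite -(subrKA s') (le_lt_trans (ler_normD _ _))//; lra.
move=> [i0 [_ iP]].
pose i := Num.max 1 (i0 + 1).
have i1 : 1 <= i by rewrite le_max lexx.
have ip : 0 < i by lra.
have {}iP : `[0, M]%classic `<=` P i.
  by apply: iP; rewrite lt_max ltrDl ltr01 orbT.
exists (i + B * i) => [|s r s0 r0 sM]; first by rewrite addr_ge0 ?mulr_ge0// ltW.
have [sr|sr] := ltP `|s - r| i^-1.
  apply: (le_trans (iP s _ r r0 sr)); first by rewrite /= in_itv/= s0.
  by rewrite ler_wpM2r// lerDl mulr_ge0// ltW.
apply: (le_trans (gB s r s0 r0)).
rewrite mulrDl -[leLHS]add0r lerD ?mulr_ge0// ?(ltW ip)//.
by rewrite -mulrA ler_peMr// -ler_pdivrMl// mulr1.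
Unshelve. all: by end_near.
Qed.

(** * The concave penalty and its right derivative *)

Lemma at_rightP (R : realType) (F : R -> R) (l : R) :
  F h @[h --> 0^'+] --> l <->
  (forall e, 0 < e -> exists2 r : R, 0 < r &
     forall h, 0 < h -> h < r -> `|F h - l| <= e).
Proof.
split=> [/cvgrPdist_le Fl e /Fl[r /= r0 hr]|Fl].
  exists r => // h h0 hlt; rewrite distrC; apply: hr => //.
  by rewrite /= sub0r normrN gtr0_norm.
apply/cvgrPdist_le => e /Fl[r r0 hr]; exists r => //= h.
by rewrite /= sub0r normrN => hlt h0; rewrite distrC hr// -(gtr0_norm h0).
Qed.

Lemma within_continuous_dist (R : realType) (D : set R) (f : R -> R) (x : R) :
  {within D, continuous f} -> D x -> forall e, 0 < e ->
  exists2 r : R, 0 < r & forall y, D y -> `|y - x| < r -> `|f y - f x| <= e.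
Proof.
move=> /subspace_continuousP cf Dx e e0.
have /cvgrPdist_le/(_ _ e0) := cf _ Dx.
rewrite near_withinE => /nbhs_ballP[r /= r0 hr]; exists r => // y Dy yx.
by rewrite distrC; apply: hr; rewrite // -ball_normE/= distrC.
Qed.

Lemma right_deriv_derivable (R : realType) (f : R -> R) (s : R) :
  derivable f s 1 -> right_deriv f s = derive1 f s.
Proof.
move=> df; apply: (cvg_lim (@norm_hausdorff _ R)); apply/at_rightP => e e0.
have [r r0 hr] := derive_expansion df e0; exists r => // h h0 hlt.
have := hr h; rewrite gtr0_norm// => /(_ hlt).
have -> : f (s + h) - f s - derive1 f s * h =
    ((f (s + h) - f s) / h - derive1 f s) * h.
  by rewrite mulrBl divfK// gt_eqF.
by rewrite normrM (gtr0_norm h0) ler_pM2r.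
Qed.

Record concave_penalty (R : realType) (phi : R -> R) (ell : R) : Prop := {
  penalty_ge0 : forall s : R, 0 <= s -> 0 <= phi s;
  penalty_continuous : {within `[0, +oo[, continuous phi};
  penalty_concave : concave_on `[0, +oo[ phi;
  penalty0 : phi 0 = 0;
  penalty_derivable : forall s : R, 0 < s -> derivable phi s 1;
  penalty_slope0 : (derive1 phi s) @[s --> 0^'+] --> ell }.

Section ConcavePenalty.
Context {R : realType}.
Variables (phi : R -> R) (ell : R).
Hypothesis phiP : concave_penalty phi ell.

Let phi_ge0 := penalty_ge0 phiP.
Let phi_cont := penalty_continuous phiP.
Let phi_concave := penalty_concave phiP.
Let phi0 := penalty0 phiP.
Let phi_diff := penalty_derivable phiP.
Let phi_ell := penalty_slope0 phiP.

Let tangent_pos (s r : R) : 0 < s -> 0 <= r ->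
  phi r <= phi s + derive1 phi s * (r - s).
Proof.
move=> s0 r0; apply: (concave_tangent phi_concave).
- by rewrite /= in_itv/= ltW.
- by rewrite /= in_itv/= r0.
- exact: phi_diff.
Qed.

Let derive_ge0 (s : R) : 0 < s -> 0 <= derive1 phi s.
Proof.
move=> s0; rewrite leNgt; apply/negP => d0.
have ps := phi_ge0 (ltW s0).
(* a negative slope would make the tangent line, hence [phi],
   negative far away *)
set q := (phi s + 1) / - derive1 phi s.
have q0 : 0 < q by rewrite divr_gt0 ?oppr_gt0// ltr_wpDl.
have qd : derive1 phi s * q = - (phi s + 1).
  by rewrite /q; field; rewrite lt_eqF.
have r0 : 0 <= s + q by rewrite addr_ge0 ?ltW.
have := tangent_pos s0 r0; have := phi_ge0 r0.
by rewrite addrAC subrr add0r qd; lra.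
Qed.

Let derive_near0 (e : R) : 0 < e -> exists2 r : R, 0 < r &
  forall s : R, 0 < s -> s < r -> `|derive1 phi s - ell| <= e.
Proof. by move=> e0; have /at_rightP/(_ _ e0) := phi_ell. Qed.

Let ell_ge0 : 0 <= ell.
Proof.
apply/ler_addgt0Pl => e e0; have [r r0 hr] := derive_near0 e0.
have r20 : 0 < r / 2 by rewrite divr_gt0.
have := derive_ge0 r20.
have := hr _ r20; rewrite ltr_pdivrMr// ltr_pMr// ltr1n => /(_ isT).
by rewrite ler_distl => /andP[_]; lra.
Qed.

Let derive_le (s : R) : 0 < s -> derive1 phi s <= ell.
Proof.
move=> s0; apply/ler_addgt0Pr => e e0; have [r r0 hr] := derive_near0 e0.
pose h := Num.min (r / 2) (s / 2).
have h0 : 0 < h by rewrite lt_min !divr_gt0.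
have hs : h < s by rewrite gt_min orbC ltr_pdivrMr// ltr_pMr// ltr1n.
have hrr : h < r by rewrite gt_min ltr_pdivrMr// ltr_pMr// ltr1n.
have := hr h h0 hrr; rewrite ler_distl => /andP[_]; apply: le_trans.
have := tangent_pos h0 (ltW s0); have := tangent_pos s0 (ltW h0) => h1 h2.
rewrite -subr_ge0 -(pmulr_lge0 _ (_ : 0 < s - h)) ?subr_gt0//.
by lra.
Qed.

Let phi_near0 (e : R) : 0 < e -> exists2 r : R, 0 < r &
  forall s : R, 0 < s -> s < r -> phi s <= e.
Proof.
move=> e0; have D0 : `[0, +oo[%classic (0 : R) by rewrite /= in_itv/= lexx.
have [r r0 hr] := within_continuous_dist phi_cont D0 e0.
exists r => // s s0 sr; apply: le_trans (ler_norm _) _.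
rewrite -[phi s]subr0 -phi0; apply: hr; first by rewrite /= in_itv/= ltW.
by rewrite subr0 gtr0_norm.
Qed.

(* Tangent lines at points tending to [0] have intercept [phi h -> 0] and slope
   at most [ell]. *)
Let phi_le (s : R) : 0 <= s -> phi s <= ell * s.
Proof.
rewrite le_eqVlt => /predU1P[<-|s0]; first by rewrite phi0 mulr0.
apply/ler_addgt0Pr => e e0.
have [r r0 hr] := phi_near0 e0.
pose h := Num.min (r / 2) (s / 2).
have h0 : 0 < h by rewrite lt_min !divr_gt0.
have hs : h < s by rewrite gt_min orbC ltr_pdivrMr// ltr_pMr// ltr1n.
have hrr : h < r by rewrite gt_min ltr_pdivrMr// ltr_pMr// ltr1n.
have := tangent_pos h0 (ltW s0); have := hr _ h0 hrr.
have := ler_wpM2r (_ : 0 <= s - h) (derive_le h0).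
rewrite subr_ge0 => /(_ (ltW hs)).
have := mulr_ge0 ell_ge0 (ltW h0).
by lra.
Qed.

(* [phi h / h] lies between [phi' h] and [ell]. *)
Let right_deriv0 : right_deriv phi 0 = ell.
Proof.
apply: (cvg_lim (@norm_hausdorff _ R)); apply/at_rightP => e e0.
have [r r0 hr] := derive_near0 e0; exists r => // h h0 hlt.
rewrite add0r phi0 subr0 ler_distl.
have := hr h h0 hlt; rewrite ler_distl => /andP[h1 _].
rewrite ler_pdivlMr// ler_pdivrMr//.
have := tangent_pos h0 (lexx 0); rewrite phi0.
have := phi_le (ltW h0).
have := ler_wpM2r (ltW h0) h1.
have := mulr_ge0 (ltW e0) (ltW h0).
by move=> ? ? ? ?; apply/andP; split; lra.
Qed.

Lemma weight_ge0 (s : R) : 0 <= s -> 0 <= right_deriv phi s.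
Proof.
rewrite le_eqVlt => /predU1P[<-|s0]; first by rewrite right_deriv0.
by rewrite right_deriv_derivable ?derive_ge0//; exact: phi_diff.
Qed.

Lemma weight_le (s : R) : 0 <= s -> right_deriv phi s <= ell.
Proof.
rewrite le_eqVlt => /predU1P[<-|s0]; first by rewrite right_deriv0.
by rewrite right_deriv_derivable ?derive_le//; exact: phi_diff.
Qed.

Lemma weight_tangent (s r : R) : 0 <= s -> 0 <= r ->
  phi r <= phi s + right_deriv phi s * (r - s).
Proof.
rewrite le_eqVlt => /predU1P[<-|s0] r0.
  by rewrite right_deriv0 phi0 subr0 add0r phi_le.
by rewrite right_deriv_derivable ?tangent_pos//; exact: phi_diff.
Qed.

Lemma weight_dist (s r : R) : 0 <= s -> 0 <= r ->
  `|right_deriv phi s - right_deriv phi r| <= ell.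
Proof.
move=> s0 r0; rewrite ler_norml.
have := weight_ge0 s0; have := weight_ge0 r0.
have := weight_le s0; have := weight_le r0.
by move=> *; apply/andP; split; lra.
Qed.

Lemma penalty_lipschitz (s r : R) : 0 <= s -> 0 <= r ->
  `|phi s - phi r| <= ell * `|s - r|.
Proof.
wlog rs : s r / r <= s => [hw s0 r0|s0 r0].
  have [/hw|/ltW/hw] := leP r s; first exact.
  by rewrite distrC (distrC s); exact.
have sr0 : 0 <= s - r by rewrite subr_ge0.
rewrite (ger0_norm sr0) ler_norml; apply/andP; split.
  have := weight_tangent s0 r0; have := mulr_ge0 (weight_ge0 s0) sr0.
  have := mulr_ge0 ell_ge0 sr0.
  by lra.
have := weight_tangent r0 s0; have := ler_wpM2r sr0 (weight_le r0).
by lra.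
Qed.

(** [m * xi] is a regular subgradient of [phi o abs] at [a].  At a nonzero point
    this is differentiability; at [0] every slope of absolute value at most [ell]
    is admissible because [phi s >= phi' s * s] for [s > 0] (the tangent at [s]
    lies above the graph at [0]) and [phi' s] tends to [ell]. *)
Lemma abs_penalty_subgradient (a m xi : R) :
  `|xi| <= 1 -> xi * a = `|a| -> 0 <= m <= ell ->
  (a != 0 -> m = right_deriv phi `|a|) ->
  forall e, 0 < e -> exists2 r : R, 0 < r & forall b, `|b - a| < r ->
    phi `|a| + m * xi * (b - a) - e * `|b - a| <= phi `|b|.
Proof.
move=> xi1 xia /andP[m0 mell] ma e e0; have [a0|a0] := eqVneq a 0.
  have [r r0 hr] := derive_near0 e0; exists r => // b.
  rewrite a0 subr0 normr0 phi0 add0r => br.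
  have [->|b0] := eqVneq b 0; first by rewrite mulr0 normr0 mulr0 subrr phi0.
  have nb0 : 0 < `|b| by rewrite normr_gt0.
  have := tangent_pos nb0 (lexx 0); rewrite phi0.
  have := hr _ nb0 br; rewrite ler_distl => /andP[h1 _].
  have := ler_wpM2r (ltW nb0) h1.
  have : m * xi * b <= ell * `|b|.
    apply: le_trans (ler_norm _) _; rewrite !normrM ler_wpM2r//.
    by rewrite (ger0_norm m0) (le_trans _ mell)// ler_piMr.
  by lra.
have na0 : 0 < `|a| by rewrite normr_gt0.
rewrite (ma a0) right_deriv_derivable; last exact: phi_diff.
have [r r0 hr] := derive_expansion (phi_diff na0) e0.
have xixi : xi * xi = 1.
  have : `|xi| = 1.
    have := congr1 Num.norm xia; rewrite normrM normr_id.
    by move=> /(canRL (mulfK (lt0r_neq0 na0))); rewrite divff// gt_eqF.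
  by rewrite -expr2 -real_normK ?num_real// => ->; rewrite expr1n.
exists (Num.min r `|a|); first by rewrite lt_min r0.
move=> b; rewrite lt_min => /andP[br ba].
have xn : `|xi * (b - a)| <= `|b - a| by rewrite normrM ler_piMl.
have bE : `|b| = `|a| + xi * (b - a).
  rewrite mulrBr xia subrKC -[LHS]mul1r -(_ : `|xi| = 1).
    rewrite -normrM ger0_norm//.
    have : - `|a| < xi * (b - a).
      by rewrite ltrNl (le_lt_trans (ler_norm _))// normrN (le_lt_trans xn).
    by rewrite mulrBr xia; lra.
  by apply/eqP; rewrite -sqrp_eq1// real_normK ?num_real// expr2 xixi.
have := hr _ (le_lt_trans xn br).
rewrite -bE ler_norml => /andP[+ _].
have := ler_wpM2l (ltW e0) xn.
by rewrite mulrA; lra.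
Qed.

End ConcavePenalty.

(** * Optimality in the tangent-space subproblem *)

Section SublinearSelection.
Context {R : realType} {n : nat}.
Implicit Types (q : 'cV[R]_n -> R) (w e : 'cV[R]_n).

Definition sublinear q :=
  (forall e e', q (e + e') <= q e + q e') /\
  (forall s e, 0 <= s -> q (s *: e) = s * q e).

(** The one-dimensional Hahn-Banach step: [c] is squeezed between the values
    [- q e] with [<w, e> = 1] and the values [q e'] with [<w, e'> = -1], which is
    possible because [q e + q e' >= q (e + e') >= 0], as [<w, e + e'> = 0]. *)
Lemma abs_linear_selection q w : sublinear q ->
  (forall e, 0 <= q e + `|edot w e|) ->
  exists2 c, `|c| <= 1 & forall e, 0 <= q e + c * edot w e.
Proof.
move=> [qD qZ] h.
pose S := [set - q e | e in [set e | edot w e = 1]] `|` [set -1 : R].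
have Sub r : S r -> r <= 1.
  by case=> [[e /= we <-]|->]; [have := h e; rewrite we normr1|]; lra.
have supS : has_sup S by split; [exists (-1); right | exists 1 => r /Sub].
have c1 : sup S <= 1 by apply: ge_sup; [exists (-1); right | move=> r /Sub].
have c2 : -1 <= sup S by apply: sup_ubound; [exact: supS.2 | right].
exists (sup S); first by rewrite ler_norml c2.
have pos e : edot w e = 1 -> 0 <= q e + sup S.
  move=> we; have : - q e <= sup S.
    by apply: sup_ubound; [exact: supS.2 | left; exists e].
  by lra.
have neg e : edot w e = -1 -> 0 <= q e - sup S.
  move=> we; rewrite subr_ge0; apply: ge_sup; first by exists (-1); right.
  move=> r [[e' /= we' <-]|->]; last by have := h e; rewrite we normrN1; lra.
  have := h (e + e'); rewrite edotDr we we' addNr normr0 addr0.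
  by have := qD e e'; lra.
move=> e; case: (ltgtP (edot w e) 0) => we.
- have we' : 0 < - (edot w e)^-1 by rewrite oppr_gt0 invr_lt0.
  have := neg (- (edot w e)^-1 *: e); rewrite edotZr mulNr mulVf ?lt_eqF//.
  move=> /(_ erefl); rewrite (qZ _ _ (ltW we')) => hh.
  have := mulr_ge0 (_ : 0 <= - edot w e) hh; rewrite oppr_ge0 => /(_ (ltW we)).
  by rewrite mulrBr mulrA mulrNN mulfV ?lt_eqF//; lra.
- have we' : 0 < (edot w e)^-1 by rewrite invr_gt0.
  have := pos ((edot w e)^-1 *: e); rewrite edotZr mulVf ?gt_eqF//.
  move=> /(_ erefl); rewrite (qZ _ _ (ltW we')) => hh.
  have := mulr_ge0 (ltW we) hh.
  by rewrite mulrDr mulrA mulfV ?gt_eqF//; lra.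
- by have := h e; rewrite we normr0 mulr0.
Qed.

Lemma sum_abs_linear_selection (I : eqType) (s : seq I) (w : I -> 'cV[R]_n) q :
  uniq s -> sublinear q ->
  (forall e, 0 <= q e + \sum_(i <- s) `|edot (w i) e|) ->
  exists2 c : I -> R, forall i, `|c i| <= 1 &
    forall e, 0 <= q e + \sum_(i <- s) c i * edot (w i) e.
Proof.
elim: s q => [q _ _ h|j s ih q /= /andP[js us] [qD qZ] h].
  by exists (fun=> 0) => [i|e]; rewrite ?normr0//; have := h e; rewrite !big_nil.
have [|e|c c1 hc] := ih (fun e => q e + `|edot (w j) e|) us.
- split=> [e e'|r e r0].
    by have := qD e e'; have := ler_normD (edot (w j) e) (edot (w j) e');
      rewrite edotDr; lra.
  by rewrite qZ// edotZr normrM ger0_norm// mulrDr.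
- by have := h e; rewrite big_cons addrA.
have [|e|a a1 ha] := @abs_linear_selection
    (fun e => q e + \sum_(i <- s) c i * edot (w i) e) (w j).
- split=> [e e'|r e r0].
    rewrite addrACA -big_split/= lerD// le_eqVlt; apply/orP; left; apply/eqP.
    by apply: eq_bigr => i _; rewrite edotDr mulrDr.
  rewrite qZ// mulrDr mulr_sumr; congr (_ + _).
  by apply: eq_bigr => i _; rewrite edotZr mulrCA.
- by have := hc e; rewrite addrAC.
exists (fun i => if i == j then a else c i) => [i|e]; first by case: ifP.
rewrite big_cons eqxx addrCA addrC.
rewrite (eq_big_seq (fun i => c i * edot (w i) e)) ?ha// => i si.
by case: eqP => // ij; rewrite -ij si in js.
Qed.

End SublinearSelection.

(** First-order expansion of [|z + s w|] with a remainder valid for all [s > 0]: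
    for [z <> 0] it is [2 |z| |z + s w| <= |z|^2 + (z + s w)^2].  For [z = 0] the
    inverse of [0] being [0] makes the quadratic term vanish, as it should. *)
Lemma abs_quadratic_bound (R : realType) (z w s : R) : 0 < s ->
  `|z + s * w| <= `|z| + s * (Num.sg z * w + (z == 0)%:R * `|w|)
                  + s ^+ 2 * (w ^+ 2 / (2 * `|z|)).
Proof.
move=> s0; have [->|z0] := eqVneq z 0.
  rewrite sgr0 normr0 mulr0 invr0 !mulr0 mul0r !add0r mul1r addr0.
  by rewrite normrM gtr0_norm.
have nz : 0 < `|z| by rewrite normr_gt0.
rewrite mul0r addr0.
have zz : Num.sg z * `|z| = z by rewrite -numEsg.
have ss : Num.sg z ^+ 2 = 1 by rewrite sqr_sg z0.
rewrite -(ler_pM2l nz) -subr_ge0.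
have -> : `|z| * (`|z| + s * (Num.sg z * w) + s ^+ 2 * (w ^+ 2 / (2 * `|z|))) =
    `|z| ^+ 2 + s * w * (Num.sg z * `|z|) + (s * w) ^+ 2 / 2.
  by field; rewrite gt_eqF.
rewrite zz.
have zE : `|z| ^+ 2 = z ^+ 2 by rewrite real_normK ?num_real.
have := sqr_ge0 (`|z| - `|z + s * w|).
have : `|z + s * w| ^+ 2 = (z + s * w) ^+ 2 by rewrite real_normK ?num_real.
set A := `|z + s * w|; set B := `|z| in zE *; set C := s * w.
by rewrite sqrrB sqrrD; lra.
Qed.

Lemma ge0_first_order (R : realType) (D K : R) :
  (forall s, 0 < s -> 0 <= s * D + s ^+ 2 * K) -> 0 <= D.
Proof.
move=> h; apply/ler_addgt0Pr => e e0.
have K0 : 0 < `|K| + 1 by rewrite ltr_wpDl.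
have s0 : 0 < e / (`|K| + 1) by rewrite divr_gt0.
have := h _ s0; rewrite expr2 -mulrA -mulrDr pmulr_rge0//.
have : e / (`|K| + 1) * K <= e.
  rewrite -mulrA ler_piMr ?(ltW e0)// mulrC ler_pdivrMr// mul1r.
  by rewrite (le_trans (ler_norm _))// lerDl.
by lra.
Qed.

Section Optimality.
Context {R : realType} {n p : nat}.
Variables (Y : 'M[R]_(n, p)) (t : R) (u : 'cV[R]_p) (x d : 'cV[R]_n).
Hypothesis u_ge0 : forall i, 0 <= u i 0.
Hypothesis x1 : enorm x = 1.
Hypothesis d_min : subproblem_minimizer Y t u x d.

Let z (i : 'I_p) : R := (Y^T *m (x + d)) i 0.
Let g := Y *m (\col_i (u i 0 * Num.sg (z i))) + t^-1 *: d.
Let P (e : 'cV[R]_n) := e - edot x e *: x.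

(* The right-hand side is the directional derivative of the model at its
   minimizer [d]. *)
Let directional e : edot x e = 0 ->
  0 <= edot g e + \sum_i (z i == 0)%:R * (u i 0 * `|(Y^T *m e) i 0|).
Proof.
move=> xe; pose w i := (Y^T *m e) i 0.
apply: (@ge0_first_order _ _ (\sum_i u i 0 * (w i ^+ 2 / (2 * `|z i|)) +
                              (2 * t)^-1 * edot e e)) => s s0.
have /(d_min.2) : edot x (d + s *: e) = 0.
  by rewrite edotDr edotZr xe d_min.1 mulr0 addr0.
rewrite /subproblem !sqr_enorm -subr_ge0 => /le_trans; apply.
have zE i : (Y^T *m (x + (d + s *: e))) i 0 = z i + s * w i.
  by rewrite addrA mulmxDr -scalemxAr mxE [X in _ + X]mxE.
rewrite [edot (d + _) _]edotDl !edotDr !edotZl !edotZr (edotC e d).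
rewrite {1}/g edotDl edot_mulmx edotZl.
have : \sum_i u i 0 * `|(Y^T *m (x + (d + s *: e))) i 0| <=
    \sum_i u i 0 * `|z i| +
    s * (\sum_i (\col_i (u i 0 * Num.sg (z i))) i 0 * w i +
         \sum_i (z i == 0)%:R * (u i 0 * `|w i|)) +
    s ^+ 2 * \sum_i u i 0 * (w i ^+ 2 / (2 * `|z i|)).
  rewrite -big_split/= !mulr_sumr -!big_split/=; apply: ler_sum => i _.
  rewrite zE mxE; have := ler_wpM2l (u_ge0 i) (abs_quadratic_bound (z i) (w i) s0).
  by move/le_trans; apply; rewrite le_eqVlt; apply/orP; left; apply/eqP; ring.
rewrite -/w.
have tE : (2 * t)^-1 = t^-1 / 2 by rewrite invfM mulrC.
rewrite tE -/(z _).
set A := \sum_i u i 0 * `|_|; set B := \sum_i u i 0 * `|z i|.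
set C := \sum_i _ * w i; set E := \sum_i (_ == _)%:R * _; set F := \sum_i _ * (_ / _).
by move=> AB; lra.
Qed.

(** First-order optimality of the tangent-space subproblem, with explicit
    subgradients [xi i] of the absolute value at [z i] and a multiplier for the
    constraint.  Where [z i = 0] the sign is free, and it is chosen by
    Hahn-Banach, applied to the directional derivative along the projection
    [P e = e - <x, e> x] of an arbitrary direction [e]; the vector that represents
    the resulting linear form is then killed by [P], so it is a multiple of
    [x]. *)
Lemma subproblem_optimality : exists (xi : 'I_p -> R) (lam : R),
  (forall i, `|xi i| <= 1 /\
             xi i * (Y^T *m (x + d)) i 0 = `|(Y^T *m (x + d)) i 0|) /\
  Y *m (\col_i (u i 0 * xi i)) + t^-1 *: d = lam *: x.
Proof.
have xx : edot x x = 1 by rewrite -sqr_enorm x1 expr1n.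
have PE a e : edot a (P e) = edot (P a) e.
  by rewrite /P edotDr edotDl edotNr edotNl edotZr edotZl (edotC a x) mulrC.
have xP e : edot x (P e) = 0 by rewrite /P edotDr edotNr edotZr xx mulr1 subrr.
pose w i := ((z i == 0)%:R * u i 0) *: P (col i Y).
have [||c c1 hc] := @sum_abs_linear_selection R n _ (index_enum 'I_p) w
    (edot (P g)) (index_enum_uniq _).
- by split=> [e e'|s e _]; rewrite ?edotDr ?edotZr.
- move=> e; have := directional (xP e); rewrite PE => /le_trans; apply.
  rewrite lerD2l le_eqVlt; apply/orP; left; apply/eqP; apply: eq_bigr => i _.
  rewrite /w edotZl -PE -trmx_mulE normrM mulrA (ger0_norm (_ : 0 <= _ * u i 0))//.
  by rewrite mulr_ge0.
pose xi i := if z i == 0 then c i else Num.sg (z i).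
exists xi; set h := Y *m _ + _; exists (edot x h); split.
  move=> i; rewrite /xi -/(z i); have [->|zi] := eqVneq.
    by rewrite mulr0 normr0.
  by rewrite normr_sg zi lexx -normrEsg.
have hE : h = g + \sum_i c i *: (((z i == 0)%:R * u i 0) *: col i Y).
  rewrite /h /g addrAC; congr (_ + _).
  apply/matrixP => k l; rewrite ord1 !mxE summxE -big_split/=.
  apply: eq_bigr => i _; rewrite !mxE /xi.
  by have [->|_] := eqVneq (z i); rewrite ?sgr0 /=; ring.
have PhE e : edot (P h) e = edot (P g) e + \sum_i c i * edot (w i) e.
  rewrite -!PE hE edotDl; congr (_ + _).
  have sumE (F : 'I_p -> 'cV[R]_n) a : edot (\sum_i F i) a = \sum_i edot (F i) a.
    elim/big_ind2 : _ => // [|? ? ? ? <- <-]; last by rewrite edotDl.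
    by rewrite -[0](scale0r (0 : 'cV[R]_n)) edotZl mul0r.
  by rewrite sumE; apply: eq_bigr => i _; rewrite /w !edotZl PE.
(* a linear form that is nonnegative everywhere vanishes *)
have : 0 <= edot (P h) (- P h) by rewrite PhE; exact: hc.
rewrite edotNr oppr_ge0 -sqr_enorm.
have := sqr_ge0 (enorm (P h)) => Ph1 Ph2.
have : enorm (P h) ^+ 2 == 0 by rewrite eq_le Ph1 Ph2.
by rewrite sqrf_eq0 => /eqP/enorm_eq0/eqP; rewrite subr_eq0 => /eqP.
Qed.

End Optimality.

(** * Regular subgradients of the penalized objective *)

Section SphereSubgradient.
Context {R : realType} {n p : nat}.
Variables (phi : R -> R) (Y : 'M[R]_(n, p)).

Lemma penalized_sphere x : sphere R n x ->
  penalized phi Y x = (objective phi Y x)%:E.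
Proof. by move=> xS; rewrite /penalized /indicator mem_set// adde0. Qed.

Lemma penalized_off x : ~ sphere R n x -> penalized phi Y x = +oo%E.
Proof. by move=> xS; rewrite /penalized /indicator memNset. Qed.

(** Off the sphere the difference quotient of [F] is [+oo], so only the points of
    the sphere matter for its lower limit. *)
Lemma regular_subdiff_sphere x v : sphere R n x ->
  (forall e, 0 < e -> \forall y \near x, sphere R n y ->
     objective phi Y x + edot v (y - x) - e * enorm (y - x) <= objective phi Y y) ->
  regular_subdiff (penalized phi Y) x v.
Proof.
move=> xS H; rewrite /regular_subdiff /= (penalized_sphere xS); split.
  by rewrite ltry.
rewrite limf_einfE; apply/lee_subgt0Pr => e e0; rewrite sub0e.
pose W := [set y : 'cV[R]_n | y != x /\ (sphere R n y ->
  objective phi Y x + edot v (y - x) - e * enorm (y - x) <= objective phi Y y)].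
apply: (@le_trans _ _ (ereal_inf [set
    ((penalized phi Y y - (objective phi Y x)%:E - (edot v (y - x))%:E)
       / (enorm (y - x))%:E)%E | y in W])).
  apply: le_ereal_inf_tmp => _ [y [yx hy] <-].
  have yx0 : 0 < enorm (y - x).
    rewrite lt_def enorm_ge0 andbT; apply: contra yx => /eqP/enorm_eq0/eqP.
    by rewrite subr_eq0.
  rewrite inver gt_eqF//.
  have [yS|yS] := pselect (sphere R n y).
    rewrite (penalized_sphere yS) -!EFinB -EFinM lee_fin ler_pdivlMr// mulNr.
    by have := hy yS; lra.
  by rewrite (penalized_off yS) /= gt0_mulye ?leey// lte_fin invr_gt0.
apply: ereal_sup_ubound; exists W => //.
by rewrite /dnbhs/= /within/=; have := H e e0; apply: filterS => y hy yx.
Qed.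

Variable ell : R.
Hypothesis phiP : concave_penalty phi ell.

Lemma objective_lipschitz x y : `|objective phi Y x - objective phi Y y| <=
  p%:R * (ell * mxbound Y) * enorm (x - y).
Proof.
have ell0 : 0 <= ell.
  have h := weight_le phiP (lexx 0).
  exact: le_trans (weight_ge0 phiP (lexx 0)) h.
rewrite /objective -sumrB; apply: le_trans (ler_norm_sum _ _ _) _.
apply: (@le_trans _ _ (\sum_(i < p) ell * mxbound Y * enorm (x - y))); last first.
  by rewrite sumr_const card_ord -[leLHS]mulr_natl !mulrA.
apply: ler_sum => i _.
apply: le_trans (penalty_lipschitz phiP _ _) _ => //.
rewrite -mulrA ler_wpM2l//; apply: le_trans (ler_dist_dist _ _) _.
apply: le_trans (trmx_mul_le Y i (x - y)).
by rewrite mulmxBr [X in _ <= `|X|]mxE [X in _ <= `|_ + X|]mxE.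
Qed.

(** Subgradients of [f] at a point of the sphere add up coordinate by coordinate,
    and the normal space of the sphere at [x] is the line of [x], as
    [<x, y - x> = - |y - x|^2 / 2] for unit vectors. *)
Lemma sphere_subgradient x (m xi : 'I_p -> R) mu : sphere R n x ->
  (forall i, [/\ `|xi i| <= 1, xi i * (Y^T *m x) i 0 = `|(Y^T *m x) i 0|,
    0 <= m i <= ell &
    ((Y^T *m x) i 0 != 0 -> m i = right_deriv phi `|(Y^T *m x) i 0|)]) ->
  regular_subdiff (penalized phi Y) x (Y *m (\col_i (m i * xi i)) + mu *: x).
Proof.
move=> xS h; apply: regular_subdiff_sphere => // e e0.
set C := mxbound Y; have C0 : 0 <= C := mxbound_ge0 Y.
pose e1 := e / 2 / (p%:R * C + 1).
have pC : 0 <= p%:R * C by rewrite mulr_ge0.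
have e10 : 0 < e1 by rewrite !divr_gt0// ltr_wpDl.
pose a i := (Y^T *m x) i 0.
have near_i i : \forall y \near x, phi `|a i| +
    m i * xi i * ((Y^T *m y) i 0 - a i) - e1 * `|(Y^T *m y) i 0 - a i|
    <= phi `|(Y^T *m y) i 0|.
  have [h1 h2 h3 h4] := h i.
  have [r r0 hr] := abs_penalty_subgradient phiP h1 h2 h3 h4 e10.
  have C1 : 0 < C + 1 by rewrite ltr_wpDl.
  apply/nbhs_enormP; exists (r / (C + 1)) => [|y yx]; first by rewrite divr_gt0.
  apply: hr; rewrite /a.
  have -> : (Y^T *m y) i 0 - (Y^T *m x) i 0 = (Y^T *m (y - x)) i 0.
    by rewrite mulmxBr [RHS]mxE [X in _ = _ + X]mxE.
  apply: le_lt_trans (trmx_mul_le _ _ _) _.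
  apply: (@le_lt_trans _ _ ((C + 1) * enorm (y - x))).
    by rewrite ler_wpM2r ?enorm_ge0// lerDl.
  by rewrite mulrC -ltr_pdivlMr.
have near_mu : \forall y \near x, `|mu| * enorm (y - x) <= e.
  have mu1 : 0 < `|mu| + 1 by rewrite ltr_wpDl.
  apply/nbhs_enormP; exists (e / (`|mu| + 1)) => [|y yx]; first by rewrite divr_gt0.
  apply: (@le_trans _ _ ((`|mu| + 1) * enorm (y - x))).
    by rewrite ler_wpM2r ?enorm_ge0// lerDl.
  by rewrite mulrC -ler_pdivlMr// ltW.
have := filter_forall (nbhs_filter x) near_i.
move: near_mu; apply: filterS2 => y hmu hi yS.
set N := enorm (y - x) in hmu *.
have N0 : 0 <= N := enorm_ge0 _.
have dE i : (Y^T *m y) i 0 - a i = (Y^T *m (y - x)) i 0.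
  by rewrite mulmxBr [RHS]mxE [X in _ = _ + X]mxE.
rewrite edotDl edot_mulmx edotZl.
have -> : edot x (y - x) = - N ^+ 2 / 2.
  have xx : edot x x = 1 by rewrite -sqr_enorm xS expr1n.
  have yy : edot y y = 1 by rewrite -sqr_enorm yS expr1n.
  rewrite /N sqr_enorm edotDl !edotDr !edotNl !edotNr xx yy (edotC y x).
  by field.
have sumi : objective phi Y x + \sum_i (\col_i0 (m i0 * xi i0)) i 0 *
    (Y^T *m (y - x)) i 0 - e / 2 * N <= objective phi Y y.
  have : \sum_(i < p) (phi `|a i| + m i * xi i * (Y^T *m (y - x)) i 0 - e1 * (C * N))
      <= objective phi Y y.
    apply: ler_sum => i _; apply: le_trans (hi i); rewrite dE lerB//.
    by rewrite ler_wpM2l ?(ltW e10)// trmx_mul_le.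
  rewrite !big_split/= sumr_const card_ord => /(le_trans _); apply.
  apply: lerD; first (apply: lerD => //).
    rewrite le_eqVlt; apply/orP; left; apply/eqP.
    by apply: eq_bigr => i _; rewrite mxE.
  rewrite -[leRHS]mulr_natl mulrN lerN2.
  have -> : p%:R * (e1 * (C * N)) = e1 * (p%:R * C) * N by ring.
  rewrite ler_wpM2r//.
  rewrite /e1 mulrAC ler_pdivrMr ?ltr_wpDl// ler_wpM2l ?divr_ge0 ?(ltW e0)//.
  by rewrite lerDl.
have h2 : `|mu * N ^+ 2| <= e * N.
  by rewrite normrM (ger0_norm (sqr_ge0 N)) expr2 mulrA ler_wpM2r.
have := le_trans (ler_norm _) h2; rewrite -normrN in h2.
have := le_trans (ler_norm _) h2.
by move: sumi; set S := \sum_i _; lra.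
Qed.

End SphereSubgradient.

(** * One step of the method *)

Section Step.
Context {R : realType} {n p : nat}.
Variables (phi : R -> R) (ell : R) (Y : 'M[R]_(n, p)) (t K : R).
Hypothesis phiP : concave_penalty phi ell.
Hypothesis t0 : 0 < t.
Hypothesis K0 : 0 <= K.
Hypothesis weight_lip : forall s r : R, 0 <= s -> 0 <= r -> s <= mxbound Y ->
  `|right_deriv phi s - right_deriv phi r| <= K * `|s - r|.

Variables (x d : 'cV[R]_n).
Hypothesis xS : sphere R n x.
Hypothesis d_min : subproblem_minimizer Y t (weights phi Y x) x d.

Let N := enorm (x + d).
Let x' := N^-1 *: (x + d).

Let xx : edot x x = 1.
Proof. by rewrite -sqr_enorm xS expr1n. Qed.

Let NE : N ^+ 2 = 1 + enorm d ^+ 2.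
Proof.
rewrite /N !sqr_enorm edotDl !edotDr (edotC d x) d_min.1 xx.
by rewrite addr0 add0r.
Qed.

Let N1 : 1 <= N.
Proof. by rewrite -(@expr_ge1 _ 2) ?enorm_ge0// NE lerDl sqr_ge0. Qed.

Let N0 : 0 < N. Proof. exact: lt_le_trans N1. Qed.

Lemma step_sphere : sphere R n x'.
Proof. by rewrite /sphere/= enormZ gtr0_norm ?invr_gt0// mulVf ?gt_eqF. Qed.

(** With [N = |x + d|] one has [|x' - x|^2 = 2 - 2 / N] and [|d|^2 = N^2 - 1];
    the difference is [(N - 1)^2 (N + 2) / N]. *)
Lemma step_length : enorm (x' - x) <= enorm d.
Proof.
rewrite -ler_sqr ?nnegrE ?enorm_ge0// -[leRHS](addKr 1) -NE addrC.
have x'x' : edot x' x' = 1 by rewrite -sqr_enorm step_sphere expr1n.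
have xx' : edot x x' = N^-1 by rewrite edotZr edotDr xx d_min.1 addr0 mulr1.
rewrite sqr_enorm edotDl !edotDr !edotNl !edotNr (edotC x' x) x'x' xx xx'.
rewrite -subr_ge0.
rewrite [leRHS](_ : _ = (N - 1) ^+ 2 * (N + 2) / N).
  have N2 : 0 <= N + 2 by rewrite addr_ge0// ltW.
  by rewrite divr_ge0 ?(ltW N0)// mulr_ge0 ?sqr_ge0.
by field; rewrite gt_eqF.
Qed.

Let a (i : 'I_p) : R := (Y^T *m x) i 0.
Let z (i : 'I_p) : R := (Y^T *m (x + d)) i 0.
Let u (i : 'I_p) : R := right_deriv phi `|a i|.

Let zE i : (Y^T *m x') i 0 = N^-1 * z i.
Proof. by rewrite -scalemxAr mxE. Qed.

Let uE i : weights phi Y x i 0 = u i. Proof. by rewrite mxE. Qed.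

Let u_ge0 i : 0 <= u i. Proof. exact: weight_ge0 phiP _ _. Qed.

Let optimality : exists (xi : 'I_p -> R) (lam : R),
  (forall i, `|xi i| <= 1 /\ xi i * z i = `|z i|) /\
  Y *m (\col_i (u i * xi i)) + t^-1 *: d = lam *: x.
Proof.
have [|xi [lam [h1 h2]]] := subproblem_optimality _ xS d_min.
  by move=> i; rewrite uE.
exists xi, lam; split=> //; rewrite -h2; congr (_ *m _ + _).
by apply/matrixP => i j; rewrite [LHS]mxE [RHS]mxE uE.
Qed.

(** Concavity bounds [f x' - f x] by the decrease of the weighted l1-model, and
    retraction to the sphere only decreases the model since it is positively
    homogeneous and [|x + d| >= 1]. *)
Lemma step_descent : objective phi Y x' <= objective phi Y x - t^-1 * enorm d ^+ 2.
Proof.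
have [xi [lam [hxi opt]]] := optimality.
have key : \sum_i (u i * `|z i| - u i * `|a i|) <= - (t^-1 * enorm d ^+ 2).
  (* the multiplier disappears as [d] is tangent to the sphere *)
  have := congr1 (fun h => edot h d) opt.
  rewrite edotDl edot_mulmx !edotZl d_min.1 mulr0 -sqr_enorm => /eqP.
  rewrite addr_eq0 => /eqP <-; apply: ler_sum => i _; rewrite mxE -mulrA.
  rewrite -mulrBr ler_wpM2l//.
  have -> : (Y^T *m d) i 0 = z i - a i.
    by rewrite /z /a mulmxDr [X in _ = X - _]mxE addrAC subrr add0r.
  rewrite mulrBr (hxi i).2 lerD2l lerN2 (le_trans (ler_norm _))//.
  by rewrite normrM ler_piMl// (hxi i).1.
apply: (@le_trans _ _ (objective phi Y x + \sum_i (u i * `|z i| - u i * `|a i|))).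
  rewrite /objective -big_split/=; apply: ler_sum => i _.
  apply: le_trans (weight_tangent phiP (normr_ge0 (a i)) (normr_ge0 _)) _.
  rewrite lerD2l -/(u i) -mulrBr ler_wpM2l// lerB// zE normrM ler_piMl//.
  by rewrite gtr0_norm ?invr_gt0// invf_le1.
by rewrite lerD2l.
Qed.

(** At the new iterate the signs [xi] of the optimality condition are still
    subgradients of the absolute values, as [Y^T x'] is a positive multiple of
    [Y^T (x + d)].  Replacing the old weights by the new ones (only where the
    coordinate is nonzero) turns that condition into a subgradient of [F] up to an
    error that is Lipschitz in the step. *)
Lemma step_subgradient : exists2 v, regular_subdiff (penalized phi Y) x' v &
  enorm v <= (mxbound Y * (K * mxbound Y) + mxbound Y * ell + t^-1) * enorm d.
Proof.
have [xi [lam [hxi opt]]] := optimality.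
set C := mxbound Y; have C0 : 0 <= C := mxbound_ge0 Y.
pose m i := if z i == 0 then u i else right_deriv phi `|N^-1 * z i|.
have z'0 i : (N^-1 * z i == 0) = (z i == 0).
  by rewrite mulf_eq0 invr_eq0 gt_eqF.
exists (Y *m (\col_i (m i * xi i)) + (- lam) *: x').
  apply: (sphere_subgradient phiP); first exact: step_sphere.
  move=> i; rewrite zE; have [h1 h2] := hxi i; split => //.
  - by rewrite mulrCA h2 normrM gtr0_norm// invr_gt0.
  - by rewrite /m; case: ifP => _; rewrite (weight_ge0 phiP) ?(weight_le phiP).
  - by rewrite z'0 /m => /negbTE ->.
have mu_le i : `|(\col_i ((m i - u i) * xi i)) i 0| <= K * C * enorm d.
  rewrite mxE normrM; apply: (@le_trans _ _ `|m i - u i|).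
    by rewrite ler_piMr// (hxi i).1.
  rewrite /m; have [_|zi] := eqVneq (z i) 0.
    by rewrite subrr normr0 !mulr_ge0 ?enorm_ge0.
  rewrite distrC -mulrA; apply: le_trans (weight_lip _ _ _) _ => //.
    by rewrite (le_trans (trmx_mul_le _ _ _))// (xS : enorm x = 1) mulr1.
  rewrite ler_wpM2l// distrC; apply: le_trans (ler_dist_dist _ _) _.
  rewrite -zE; have -> : (Y^T *m x') i 0 - a i = (Y^T *m (x' - x)) i 0.
    by rewrite mulmxBr [RHS]mxE [X in _ = _ + X]mxE.
  by rewrite (le_trans (trmx_mul_le _ _ _))// ler_wpM2l// step_length.
have lam_le : `|lam| <= C * ell.
  have := congr1 (edot x) opt.
  rewrite edotDr !edotZr xx d_min.1 mulr0 addr0 mulr1 => <-.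
  apply: le_trans (cauchy_schwarz _ _) _; rewrite (xS : enorm x = 1) mul1r.
  apply: mulmx_le => i; rewrite mxE normrM ger0_norm//.
  apply: (@le_trans _ _ (u i)); first by rewrite ler_piMr// (hxi i).1.
  exact: (weight_le phiP).
have -> : Y *m (\col_i (m i * xi i)) + (- lam) *: x' =
    Y *m (\col_i ((m i - u i) * xi i)) + (- lam) *: (x' - x) + (- t^-1) *: d.
  rewrite scalerBr !scaleNr opprK -opt.
  have -> : \col_i ((m i - u i) * xi i) =
      \col_i (m i * xi i) - \col_i (u i * xi i) :> 'cV[R]_p.
    by apply/matrixP => i j; rewrite !mxE mulrBl.
  rewrite mulmxBr; set A := Y *m _; set B := Y *m _; set D := t^-1 *: d.
  by rewrite -!addrA; congr (_ + _); rewrite subrr addr0 addrCA addNr addr0.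
apply: le_trans (ler_enormD _ _) _; rewrite mulrDl; apply: lerD; last first.
  by rewrite enormZ normrN gtr0_norm// invr_gt0.
apply: le_trans (ler_enormD _ _) _; rewrite mulrDl; apply: lerD.
  by rewrite -mulrA; exact: mulmx_le.
by rewrite enormZ normrN ler_pM ?enorm_ge0// step_length.
Qed.

End Step.

(** * Convergence under the Kurdyka-Lojasiewicz property *)

(** Concavity gives [psi r - psi r' >= psi' r * (r - r') >= del'^2 / (c t del)],
    that is [del'^2 <= del * w] with [w] the decrease of [c * t * psi]; the
    arithmetic-geometric mean inequality concludes. *)
Lemma kl_step (R : realType) (D : set R) (psi : R -> R) (t c r r' del del' : R) :
  concave_on D psi -> D r -> D r' -> derivable psi r 1 -> 0 < derive1 psi r ->
  0 < t -> 0 <= c -> 0 <= del -> r' <= r - t^-1 * del' ^+ 2 ->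
  1 <= derive1 psi r * (c * del) ->
  2 * del' <= del + (c * t * psi r - c * t * psi r').
Proof.
move=> psic Dr Dr' dpsi P0 t0 c0 del0 desc kl.
set P := derive1 psi r in P0 kl *.
have tan : P * (r - r') <= psi r - psi r'.
  by have := concave_tangent psic Dr Dr' dpsi; rewrite -/P; lra.
have sq : P * del' ^+ 2 <= t * (psi r - psi r').
  rewrite -ler_pdivrMl//; apply: le_trans tan.
  by rewrite mulrCA ler_wpM2l ?(ltW P0)//; lra.
have del_gt0 : 0 < del.
  rewrite lt_def del0 andbT; apply: contraTneq kl => ->.
  by rewrite !mulr0 ler10.
set w := c * t * psi r - _.
have wE : c * (t * (psi r - psi r')) = w by rewrite /w; ring.
have prod : del' ^+ 2 <= del * w.
  have h1 := ler_wpM2r (sqr_ge0 del') kl.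
  have h2 := ler_wpM2l (mulr_ge0 c0 del0) sq.
  rewrite mul1r in h1; apply: le_trans h1 _.
  have -> : del * w = c * del * (t * (psi r - psi r')) by rewrite -wE; ring.
  by have -> : P * (c * del) * del' ^+ 2 = c * del * (P * del' ^+ 2) by ring.
have w0 : 0 <= w.
  by rewrite -(pmulr_rge0 _ del_gt0) (le_trans (sqr_ge0 _) prod).
have dw := sqr_ge0 (del - w).
have [//|lt2] := leP (2 * del') (del + w).
have s0 : 0 <= del + w by rewrite addr_ge0.
have := ltr_pM s0 s0 lt2 lt2.
have -> : 2 * del' * (2 * del') = 4 * del' ^+ 2 by ring.
have : (del + w) * (del + w) = 4 * (del * w) + (del - w) ^+ 2 by ring.
by lra.
Qed.

(** Convergence from a Kurdyka-Lojasiewicz type recursion.  Here [e k] is the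
    distance to the candidate limit, [del k] the step length and [b k] the
    desingularized gap.  The recursion makes [e k.+1 + del k + b k.+1]
    nonincreasing as long as [e k.+1] is small, so the sequence cannot leave a ball
    that it enters with this quantity small. *)
Lemma kl_recursion_cvg (R : realType) (e del b : nat -> R) (rho : R) (N0 : nat) :
  0 < rho -> (forall k, 0 <= del k) -> (forall k, (N0 <= k)%N -> 0 <= b k) ->
  (forall k, e k.+1 <= e k + del k) ->
  (forall k, (N0 <= k)%N -> e k.+1 < rho ->
     2 * del k.+1 <= del k + (b k.+1 - b k.+2)) ->
  (forall eps : R, 0 < eps -> exists N, forall k, (N <= k)%N -> del k < eps) ->
  (forall eps : R, 0 < eps -> exists N, forall k, (N <= k)%N -> b k < eps) ->
  (forall (eps : R) N, 0 < eps -> exists2 k, (N <= k)%N & e k < eps) ->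
  forall eps : R, 0 < eps -> exists N, forall k, (N <= k)%N -> e k < eps.
Proof.
move=> rho0 del0 b0 eD rec delc bc ec eps eps0.
have [m [m0 me mr]] : exists m : R, [/\ 0 < m, m <= eps & m <= rho].
  exists (Num.min eps rho).
  by rewrite lt_min eps0 rho0 !ge_min !lexx orbT.
have m30 : 0 < m / 3 by rewrite divr_gt0.
have [Nd hd] := delc _ m30; have [Nb hb] := bc _ m30.
have [[//|k] kN ek] := ec _ (N0 + Nd + Nb).+1 m30.
rewrite ltnS in kN.
have kN0 : (N0 <= k)%N by apply: leq_trans kN; rewrite -addnA leq_addr.
have kNd : (Nd <= k)%N by apply: leq_trans kN; rewrite addnAC leq_addl.
have kNb : (Nb <= k.+1)%N by rewrite leqW//; apply: leq_trans kN; rewrite leq_addl.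
have inv j : e (k + j)%N.+1 + del (k + j)%N + b (k + j)%N.+1 < m.
  elim: j => [|j ih].
    by rewrite addn0; have := hd _ kNd; have := hb _ kNb; lra.
  rewrite !addnS; have kj : (N0 <= k + j)%N by rewrite (leq_trans kN0)// leq_addr.
  have bj := b0 _ (leqW kj); have dj := del0 (k + j)%N.
  have ej : e (k + j)%N.+1 < rho by lra.
  by have := rec _ kj ej; have := eD (k + j)%N.+1; lra.
exists k.+1 => -[//|i]; rewrite ltnS => ki.
have := inv (i - k)%N; rewrite subnKC// => hi.
have := b0 i.+1 (leqW (leq_trans kN0 ki)); have := del0 i.
by lra.
Qed.

Section Convergence.
Context {R : realType} {n p : nat}.
Variables (phi : R -> R) (ell : R) (Y : 'M[R]_(n, p)) (t : R).
Hypothesis phiP : concave_penalty phi ell.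
Hypothesis t0 : 0 < t.
Hypothesis phi'_lip : locally_lipschitz_on `[0, +oo[ (right_deriv phi).
Variables (x d : nat -> 'cV[R]_n).
Hypothesis x0S : sphere R n (x 0%N).
Hypothesis step : forall k,
  subproblem_minimizer Y t (weights phi Y (x k)) (x k) (d k) /\
  x k.+1 = (enorm (x k + d k))^-1 *: (x k + d k).

Let F := penalized phi Y.
Let f := objective phi Y.

Lemma iterate_sphere k : sphere R n (x k).
Proof.
elim: k => // k ih; rewrite (step k).2.
exact: (step_sphere ih (step k).1).
Qed.

Lemma iterate_length k : enorm (x k.+1 - x k) <= enorm (d k).
Proof. by rewrite (step k).2; exact: (step_length (iterate_sphere k) (step k).1). Qed.

Lemma iterate_descent k : f (x k.+1) <= f (x k) - t^-1 * enorm (d k) ^+ 2.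
Proof.
by rewrite (step k).2; exact: (step_descent phiP (iterate_sphere k) (step k).1).
Qed.

Lemma iterate_subgradient : exists2 c, 0 <= c & forall k, exists2 v,
  regular_subdiff F (x k.+1) v & enorm v <= c * enorm (d k).
Proof.
have [K K0 hK] := bounded_locally_lipschitz_itv (mxbound Y) phi'_lip (weight_dist phiP).
have ell0 : 0 <= ell.
  exact: le_trans (weight_ge0 phiP (lexx 0)) (weight_le phiP (lexx 0)).
have C0 := mxbound_ge0 Y.
exists (mxbound Y * (K * mxbound Y) + mxbound Y * ell + t^-1) => [|k].
  by rewrite !addr_ge0 ?mulr_ge0// invr_ge0 ltW.
rewrite (step k).2.
exact: (step_subgradient phiP t0 K0 hK (iterate_sphere k) (step k).1).
Qed.

Lemma objective_antitone j k : (j <= k)%N -> f (x k) <= f (x j).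
Proof.
move=> /subnKC <-; elim: (k - j)%N => [|i ih]; first by rewrite addn0.
rewrite addnS; apply: le_trans ih; apply: le_trans (iterate_descent _) _.
by rewrite gerBl mulr_ge0 ?sqr_ge0// invr_ge0 ltW.
Qed.

Variable xbar : 'cV[R]_n.
Hypothesis xbar_cluster : forall e N, 0 < e ->
  exists2 k, (N <= k)%N & enorm (x k - xbar) < e.

Let objective_near e : 0 < e -> exists2 r : R, 0 < r &
  forall y, enorm (y - xbar) < r -> `|f y - f xbar| < e.
Proof.
move=> e0; set L := p%:R * (ell * mxbound Y).
have L1 : 0 < `|L| + 1 by rewrite ltr_wpDl.
exists (e / (`|L| + 1)) => [|y yx]; first by rewrite divr_gt0.
apply: le_lt_trans (objective_lipschitz Y phiP y xbar) _.
apply: (@le_lt_trans _ _ ((`|L| + 1) * enorm (y - xbar))).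
  rewrite ler_wpM2r ?enorm_ge0// (le_trans (ler_norm _))//.
  by rewrite lerDl.
by rewrite mulrC -ltr_pdivlMr.
Qed.

(** The values decrease and accumulate at [f xbar]. *)
Lemma gap_ge0 k : f xbar <= f (x k).
Proof.
apply/ler_addgt0Pr => e e0; have [r r0 hr] := objective_near e0.
have [j kj /hr] := xbar_cluster k r0; rewrite ltr_distl => /andP[+ _].
by have := objective_antitone kj; lra.
Qed.

Lemma gap_cvg0 e : 0 < e -> exists N, forall k, (N <= k)%N -> f (x k) - f xbar < e.
Proof.
move=> e0; have [r r0 hr] := objective_near e0.
have [j _ /hr] := xbar_cluster 0 r0; rewrite ltr_distl => /andP[_ h].
by exists j => k jk; have := objective_antitone jk; lra.
Qed.

Lemma length_cvg0 e : 0 < e -> exists N, forall k, (N <= k)%N -> enorm (d k) < e.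
Proof.
move=> e0; have te : 0 < t^-1 * e ^+ 2 by rewrite mulr_gt0 ?invr_gt0 ?exprn_gt0.
have [N hN] := gap_cvg0 te; exists N => k Nk.
rewrite -ltr_sqr ?nnegrE ?enorm_ge0// ?(ltW e0)//.
have ti : 0 < t^-1 by rewrite invr_gt0.
rewrite -(ltr_pM2l ti).
by have := iterate_descent k; have := gap_ge0 k.+1; have := hN _ Nk; lra.
Qed.

Lemma cluster_sphere : sphere R n xbar.
Proof.
have le1 e : 0 < e -> `|enorm xbar - 1| <= e.
  move=> e0; have [k _ hk] := xbar_cluster 0 e0.
  have xk : enorm (x k) = 1 := iterate_sphere k.
  have h1 := ler_enormD (x k - xbar) xbar.
  have h2 := ler_enormD (- (x k - xbar)) (x k).
  rewrite subrK xk in h1; rewrite enormN opprB subrK xk in h2.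
  by rewrite ler_distl; apply/andP; split; lra.
apply/eqP; rewrite -subr_eq0 -normr_le0; apply/ler_addgt0Pr => e e0.
by rewrite add0r le1.
Qed.

(** The subgradients at [x k.+1] are bounded by multiples of [|d k|], so they tend
    to [0] along a subsequence of iterates tending to [xbar]. *)
Lemma cluster_stationary : limiting_subdiff F xbar 0.
Proof.
have [c c0 hc] := iterate_subgradient.
have e0 j : (0 : R) < j.+1%:R^-1 by rewrite invr_gt0.
have pick j : exists kv : nat * 'cV[R]_n, [/\ enorm (x kv.1.+1 - xbar) < j.+1%:R^-1,
    regular_subdiff F (x kv.1.+1) kv.2 & enorm kv.2 <= j.+1%:R^-1].
  have c1 : 0 < c + 1 by rewrite ltr_wpDl.
  have [N hN] := length_cvg0 (divr_gt0 (e0 j) c1).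
  have [[//|k] Nk xk] := xbar_cluster N.+1 (e0 j).
  have [v hv vc] := hc k; exists (k, v); split=> //=.
  apply: le_trans vc _; rewrite ltnS in Nk.
  apply: (@le_trans _ _ ((c + 1) * enorm (d k))).
    by rewrite ler_wpM2r ?enorm_ge0// lerDl.
  by rewrite mulrC -ler_pdivlMr// ltW// hN.
have [kv hkv] := choice pick.
have inv_cvg0 (w : nat -> 'cV[R]_n) (b : 'cV[R]_n) :
    (forall j, enorm (w j - b) <= j.+1%:R^-1) -> w j @[j --> \oo] --> b.
  move=> hw; apply: cvg_enorm.
  apply/cvgrPdist_lt => e ep.
  have /cvgrPdist_lt/(_ _ ep) := @cvg_harmonic R; apply: filterS => j /=.
  rewrite !sub0r !normrN !ger0_norm ?enorm_ge0 ?invr_ge0//.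
  by apply: le_lt_trans; exact: hw.
have yc : x (kv j).1.+1 @[j --> \oo] --> xbar.
  by apply: inv_cvg0 => j; have [/ltW] := hkv j.
rewrite /limiting_subdiff /= /F (penalized_sphere phi Y cluster_sphere).
split; first by rewrite ltry.
exists (fun j => x (kv j).1.+1), (fun j => (kv j).2); split => //.
- under eq_fun do rewrite (penalized_sphere phi Y (iterate_sphere _)).
  apply: cvg_EFin; first exact: nearW.
  apply/cvgrPdist_lt => e ep; have [r r0 hr] := objective_near ep.
  have xr : nbhs xbar [set y | enorm (y - xbar) < r].
    by apply/nbhs_enormP; exists r.
  have : \forall j \near \oo, enorm (x (kv j).1.+1 - xbar) < r by exact: yc _ xr.
  by apply: filterS => j /hr; rewrite distrC.
- by move=> j; have [] := hkv j.
- by apply: inv_cvg0 => j; rewrite subr0; have [] := hkv j.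
Qed.

(** [kl_recursion_cvg] applies with [b k = c t psi (f (x k) - f xbar)], once the
    gaps are below the range [a] of the Kurdyka-Lojasiewicz inequality. *)
Lemma iterate_cvg : KL_property F xbar -> x k @[k --> \oo] --> xbar.
Proof.
move=> [_ [a [V [psi [a0 nV [psi_cont psi_conc psi00 psi_ge0] psi_d psi_kl]]]]].
set D := [set s : R | _] in psi_cont psi_conc psi_ge0.
have [rho rho0 hV] := (nbhs_enormP _ _).1 nV.
have [c c0 hc] := iterate_subgradient.
pose r k := f (x k) - f xbar.
have r0 k : 0 <= r k by rewrite subr_ge0 gap_ge0.
have D0 : D 0 by split.
have [a' a'0 ha'] : exists2 a' : R, 0 < a' & (a'%:E <= a)%E.
  case: (a) a0 => [s s0|_|//]; first by exists s.
  by exists 1; rewrite ?leey.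
have [N0 hN0] := gap_cvg0 a'0.
have ra k : (N0 <= k)%N -> ((r k)%:E < a)%E.
  by move=> /hN0 h; apply: lt_le_trans ha'; rewrite lte_fin.
have Dr k : (N0 <= k)%N -> D (r k) by move=> /ra; split.
have ct0 : 0 <= c * t by rewrite mulr_ge0// ltW.
apply: cvg_enorm; apply/cvgrPdist_lt => e e0.
have [|||||||N hN] := @kl_recursion_cvg R (fun k => enorm (x k - xbar))
  (fun k => enorm (d k)) (fun k => c * t * psi (r k)) rho N0 rho0 _ _ _ _ _ _ _ e e0.
- by move=> k; exact: enorm_ge0.
- by move=> k /Dr/psi_ge0 h; rewrite mulr_ge0.
- move=> k; rewrite -(subrKA (x k)) addrC; apply: le_trans (ler_enormD _ _) _.
  by rewrite lerD2l iterate_length.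
- move=> k N0k /hV xV; have N0k1 := leqW N0k.
  have := iterate_descent k.+1; rewrite -(lerD2r (- f xbar)) addrAC -!/(r _) => desc.
  (* at a zero gap the inequality is void, but the next step is then zero *)
  have [rk0|rk] := eqVneq (r k.+1) 0.
    have ti : 0 < t^-1 by rewrite invr_gt0.
    have dk : enorm (d k.+1) = 0.
      apply/eqP; rewrite -sqrf_eq0 eq_le sqr_ge0 andbT -(pmulr_rle0 _ ti).
      by have := r0 k.+2; rewrite rk0 in desc; lra.
    have rk2 : r k.+2 = 0.
      apply/eqP; rewrite eq_le r0 andbT.
      by rewrite rk0 dk expr0n mulr0 subr0 in desc.
    by rewrite rk0 rk2 dk subrr mulr0 addr0 enorm_ge0.
  have rp : 0 < r k.+1 by rewrite lt_def rk r0.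
  have [dpsi _ P0] := psi_d _ rp (ra _ N0k1).
  apply: (kl_step psi_conc (Dr _ N0k1) (Dr _ (leqW N0k1)) dpsi P0 t0 c0 _ desc).
    exact: enorm_ge0.
  have [v vF vc] := hc k.
  have FxE : F (x k.+1) = (f (x k.+1))%:E.
    exact: penalized_sphere (iterate_sphere _).
  have FbE : F xbar = (f xbar)%:E by exact: penalized_sphere cluster_sphere.
  have := psi_kl _ xV; rewrite FxE FbE lte_fin -subr_gt0 -/(r _).
  rewrite -EFinB /= -/(r _) => /(_ rp).
  have -> : ((f (x k.+1))%:E < (f xbar)%:E + a)%E.
    have -> : (f (x k.+1))%:E = ((f xbar)%:E + (r k.+1)%:E)%E.
      by rewrite -EFinD /r subrKC.
    by rewrite lteD2lE// ra.
  move=> /(_ isT) => kl.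
  have dv : (dist0 (limiting_subdiff F (x k.+1)) <= (enorm v)%:E)%E.
    apply: ereal_inf_lbound; exists v => //; split.
      by rewrite FxE ltry.
    exists (fun=> x k.+1), (fun=> v); split => //; exact: cvg_cst.
  have := le_trans kl (lee_wpmul2l _ dv); rewrite lee_fin => /(_ (ltW P0)).
  rewrite -EFinM lee_fin => /le_trans; apply.
  by rewrite ler_wpM2l// ltW.
- exact: length_cvg0.
- move=> eps eps0.
  have ct1 : 0 < c * t + 1 by rewrite ltr_wpDl.
  have e2 : 0 < eps / 2 by rewrite divr_gt0.
  have [s s0 hs] := within_continuous_dist psi_cont D0 (divr_gt0 e2 ct1).
  have [N hN] := gap_cvg0 s0; exists (N0 + N)%N => k Nk.
  have N0k : (N0 <= k)%N := leq_trans (leq_addr _ _) Nk.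
  have := hs _ (Dr _ N0k); rewrite subr0 ger0_norm// psi00 subr0.
  rewrite (hN _ (leq_trans (leq_addl _ _) Nk)) => /(_ isT).
  move=> /(le_trans (ler_norm _)); rewrite ler_pdivlMr// mulrC => h.
  have := psi_ge0 _ (Dr _ N0k); have := h; rewrite mulrDl mul1r.
  by lra.
- exact: xbar_cluster.
exists N => // k /= Nk; rewrite sub0r normrN ger0_norm ?enorm_ge0//; exact: hN.
Qed.

End Convergence.

Theorem theorem3p3 (R : realType) (n p : nat) (Y : 'M[R]_(n, p))
    (phi : R -> R) (ell t : R)
    (phi_ge0 : forall s, 0 <= s -> 0 <= phi s)
    (phi_cont : {within `[0, +oo[, continuous phi})
    (phi_concave : concave_on `[0, +oo[ phi)
    (phi0 : phi 0 = 0)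
    (phi_diff : forall s, 0 < s -> derivable phi s 1)
    (phi_ell : phi^`() s @[s --> 0^'+] --> ell)
    (* extended-real quotient: 2 / L_f is +oo when L_f = 0 *)
    (t_range : 0 < t /\ (t%:E < 2%:E / (Lconst Y ell)%:E)%E)
    (F_KL : KL_function (penalized phi Y))
    (phi'_lip : locally_lipschitz_on `[0, +oo[ (right_deriv phi))
    (x : nat -> 'cV[R]_n) (x_gen : ManPPA_rw phi Y t x) :
  exists2 xstar : 'cV[R]_n,
    x k @[k --> \oo] --> xstar & stationary phi Y xstar.
Proof.
have phiP : concave_penalty phi ell by split.
have [t0 _] := t_range; have [x0S [d step]] := x_gen.
have [xbar clx] := sphere_cluster (iterate_sphere x0S step).
have stat := cluster_stationary phiP t0 phi'_lip x0S step clx.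
exists xbar => //.
apply: (iterate_cvg phiP t0 phi'_lip x0S step clx).
by apply: F_KL; exists 0.
Qed.
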